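(* Let $N\ge3$, $\alpha,\beta\ge0$ and $p,q>0$ satisfy $$\frac{N+\alpha}{p+1}+\frac{N+\beta}{q+1}\le N-2,$$ and let $\Omega\subset\mathbb{R}^N$ be a ball centered at the origin. Then the problem $$\begin{cases}\Delta u+|x|^\beta|v|^{q-1}v=0&\text{in }\Omega,\\ \Delta v+|x|^\alpha|u|^{p-1}u=0&\text{in }\Omega,\\ u=v=0&\text{on }\partial\Omega\end{cases}$$ does not admit any nontrivial radial classical solution $(u,v)$.
   Context: Nontrivial means $(u,v)\not\equiv(0,0)$; no sign condition is imposed on $u$ or $v$. Radial means that $u$ and $v$ depend only on $|x|$. Classical solutions of this problem are twice continuously differentiable in $\Omega$ and differentiable up to the boundary. *)

(* Defs.v *)
From mathcomp Require Import all_boot all_order all_algebra.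
From mathcomp Require Import all_classical all_reals all_analysis.

Set Implicit Arguments.
Unset Strict Implicit.
Unset Printing Implicit Defensive.

Import Order.TTheory GRing.Theory Num.Theory.
Import numFieldNormedType.Exports.

Local Open Scope classical_set_scope.
Local Open Scope ring_scope.

(* The library's norm `|x| on row vectors is the sup norm, so the Euclidean
   norm is defined here.  Both induce the same topology, and the same notions
   of continuity and differentiability. *)
Definition enorm (R : realType) (N : nat) (x : 'rV[R]_N) : R :=
  Num.sqrt (\sum_(i < N) x 0 i ^+ 2).

Definition eball (R : realType) (N : nat) (rho : R) : set 'rV[R]_N :=
  [set x | enorm x < rho].

Definition boundary (T : topologicalType) (A : set T) : set T :=
  closure A `\` interior A.

Definition partial (R : realType) (N : nat) (i : 'I_N) (f : 'rV[R]_N -> R)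
  : 'rV[R]_N -> R := fun x => 'D_(delta_mx 0 i) f x.

Definition laplacian (R : realType) (N : nat) (f : 'rV[R]_N -> R)
  (x : 'rV[R]_N) : R := \sum_(i < N) partial i (partial i f) x.

(* Meant for an open set A: [derivable] and [{for x, continuous _}] involve a
   full neighbourhood of x.  'D_v is a total operator, so the existence of each
   partial derivative is required separately. *)
Definition C2_on (R : realType) (N : nat) (A : set 'rV[R]_N)
  (f : 'rV[R]_N -> R) : Prop :=
  forall x : 'rV[R]_N, A x ->
    {for x, continuous f} /\
    forall i : 'I_N,
      derivable f x (delta_mx 0 i) /\
      {for x, continuous (partial i f)} /\
      forall j : 'I_N,
        derivable (partial i f) x (delta_mx 0 j) /\
        {for x, continuous (partial j (partial i f))}.

(* Differentiability of f relative to A at each point of A: only the values of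
   f on A matter, so this makes sense at boundary points. *)
Definition differentiable_within (R : realType) (N : nat) (A : set 'rV[R]_N)
  (f : 'rV[R]_N -> R) : Prop :=
  forall x : 'rV[R]_N, A x ->
    exists L : {scalar 'rV[R]_N}, forall e : R, 0 < e ->
      \forall y \near x,
        A y -> `|f y - f x - L (y - x)| <= e * enorm (y - x).

(* t |-> |t|^(s-1) t.  In the library 0 `^ r is 0 for r != 0 and 1 for r = 0;
   hence the value at t = 0 is 0 for every s, including s < 1. *)
Definition spow (R : realType) (s t : R) : R := `|t| `^ (s - 1) * t.

(* Functions on the closure of Omega are represented by total functions whose
   values outside of the closure are irrelevant. *)
Definition classical_solution (R : realType) (N : nat) (alpha beta p q : R)
  (Omega : set 'rV[R]_N) (u v : 'rV[R]_N -> R) : Prop :=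
  [/\ C2_on Omega u /\ C2_on Omega v,
      differentiable_within (closure Omega) u /\
      differentiable_within (closure Omega) v,
      forall x, Omega x -> laplacian u x + enorm x `^ beta * spow q (v x) = 0,
      forall x, Omega x -> laplacian v x + enorm x `^ alpha * spow p (u x) = 0 &
      forall x, boundary Omega x -> u x = 0 /\ v x = 0].

Definition radial_on (R : realType) (N : nat) (A : set 'rV[R]_N)
  (f : 'rV[R]_N -> R) : Prop :=
  forall x y : 'rV[R]_N, A x -> A y -> enorm x = enorm y -> f x = f y.

Definition nontrivial_on (R : realType) (N : nat) (A : set 'rV[R]_N)
  (u v : 'rV[R]_N -> R) : Prop :=
  exists2 x : 'rV[R]_N, A x & (u x, v x) <> (0, 0).

(* Main.v *)
(* For a radial solution write f r = u (r e_0), g r = v (r e_0), and let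
   F = r^(N-1) f', G = r^(N-1) g' be the fluxes, so that
   F' = - r^(N-1+beta) |g|^(q-1) g and G' = - r^(N-1+alpha) |f|^(p-1) f.
   A Pohozaev functional which vanishes at r = 0, is nonincreasing because of the
   hypothesis on the exponents, and equals rho^N f'(rho) g'(rho) at r = rho gives
   f'(rho) g'(rho) <= 0.  But if one boundary slope is nonzero and the other one
   is zero or of opposite sign, then following the system backwards from rho no
   sign ever changes and a flux stays away from zero, whereas both fluxes vanish
   at the origin.  Hence f = g = f' = g' = 0 at rho.  The hypothesis on the
   exponents forces p q > 1, and then a Gronwall argument for a sum of suitable
   powers of |f|, |f'|, |g|, |g'| yields f = g = 0. *)
Require Import Defs.
From mathcomp Require Import all_boot all_order all_algebra.
From mathcomp Require Import all_classical all_reals all_analysis.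
From mathcomp Require Import ring lra.

Set Implicit Arguments.
Unset Strict Implicit.
Unset Printing Implicit Defensive.

Import Order.TTheory GRing.Theory Num.Theory.
Import numFieldNormedType.Exports.

Local Open Scope classical_set_scope.
Local Open Scope ring_scope.

(** * One-variable calculus *)

(* Pointwise forms of is_deriveD, is_deriveN, is_deriveM and is_derive1_comp:
   those do not unify with functions written as [fun y => ...]. *)
Section PointwiseCalculus.
Variable R : realType.
Implicit Types (f g h dh : R -> R) (x a b : R).

Lemma is_derive_add f g x df dg : is_derive x 1 f df -> is_derive x 1 g dg ->
  is_derive x 1 (fun y => f y + g y) (df + dg).
Proof. exact: is_deriveD. Qed.

Lemma is_derive_opp f x df : is_derive x 1 f df ->
  is_derive x 1 (fun y => - f y) (- df).
Proof. exact: is_deriveN. Qed.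

Lemma is_derive_mul f g x df dg : is_derive x 1 f df -> is_derive x 1 g dg ->
  is_derive x 1 (fun y => f y * g y) (df * g x + f x * dg).
Proof.
by move=> hf hg; apply: is_derive_eq; rewrite addrC; congr (_ + _); exact: mulrC.
Qed.

Lemma is_derive_comp f g x df dg :
  is_derive (g x) 1 f df -> is_derive x 1 g dg ->
  is_derive x 1 (fun y => f (g y)) (df * dg).
Proof. exact: is_derive1_comp. Qed.

Lemma is_derive_scale (c x : R) : is_derive x 1 (fun y => c * y) c.
Proof.
apply: is_derive_eq (is_derive_mul (is_derive_cst c x 1) (is_derive_id x 1)) _.
by rewrite mul0r add0r; exact: mulr1.
Qed.

Lemma is_derive_expn x m : is_derive x 1 (fun y => y ^+ m) (m%:R * x ^+ m.-1).
Proof.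
have -> : (fun y : R => y ^+ m) = id ^+ m.
  by apply/funext => y; elim: m => [|m IH]; rewrite ?expr0 // !exprS IH.
by apply: is_derive_eq; exact: mulr1.
Qed.

Lemma derive_le0_nincr h dh a b : a <= b -> {within `[a, b], continuous h} ->
  (forall x, x \in `]a, b[ -> is_derive x 1 h (dh x)) ->
  (forall x, x \in `]a, b[ -> dh x <= 0) -> h b <= h a.
Proof.
rewrite le_eqVlt => /predU1P[-> //|ab] ch hd h0.
have [c cab] := MVT ab hd ch.
by move=> E; rewrite -subr_le0 E mulr_le0_ge0 ?h0 // subr_ge0 ltW.
Qed.

Lemma derive_ge0_ndecr h dh a b : a <= b -> {within `[a, b], continuous h} ->
  (forall x, x \in `]a, b[ -> is_derive x 1 h (dh x)) ->
  (forall x, x \in `]a, b[ -> 0 <= dh x) -> h a <= h b.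
Proof.
rewrite le_eqVlt => /predU1P[-> //|ab] ch hd h0.
have [c cab] := MVT ab hd ch.
by move=> E; rewrite -subr_ge0 E mulr_ge0 ?h0 // subr_ge0 ltW.
Qed.

End PointwiseCalculus.

(** * Powers of absolute values and signed powers *)

Section SignedPower.
Variables (R : realType) (p : R).
Hypothesis p0 : 0 < p.
Implicit Types x : R.

Lemma powR_predM s x : 0 < x -> x `^ (s - 1) * x = x `^ s.
Proof.
move=> x0; rewrite -{2}(powRr1 (ltW x0)) -powRD ?subrK //.
by rewrite (gt_eqF x0) implybT.
Qed.

Lemma normr_spow x : `|spow p x| = `|x| `^ p.
Proof. by rewrite /spow normrM ger0_norm ?powR_ge0 // mulrC mulr_powRB1. Qed.

Lemma spowN x : spow p (- x) = - spow p x.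
Proof. by rewrite /spow normrN mulrN. Qed.

Lemma spow_ge0 x : 0 <= x -> 0 <= spow p x.
Proof. by move=> x0; rewrite mulr_ge0 ?powR_ge0. Qed.

Lemma spow_le0 x : x <= 0 -> spow p x <= 0.
Proof. by move=> x0; rewrite mulr_ge0_le0 ?powR_ge0. Qed.

Lemma spow_mul x : spow p x * x = `|x| `^ (p + 1).
Proof.
have -> : spow p x * x = `|x| * (`|x| * `|x| `^ (p - 1)).
  by rewrite /spow -mulrA -expr2 -real_normK ?num_real // mulrC expr2 mulrA.
rewrite mulr_powRB1 // -[RHS]mulr_powRB1 ?addrK ?addr_gt0 //.
Qed.

Lemma is_derive_powR_norm s x : x != 0 ->
  is_derive x 1 (fun y => `|y| `^ s) (s * spow (s - 1) x).
Proof.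
rewrite neq_lt => /orP[x0|x0].
- apply: (@near_eq_is_derive _ _ _ (fun y => (- y) `^ s)).
  + by near=> y; rewrite ltr0_norm //; near: y; exact: lt_nbhsl.
  + have h : is_derive (- x) 1 (fun y => y `^ s) (s * (- x) `^ (s - 1)).
      by apply: is_derive1_powR; rewrite oppr_gt0.
    apply: is_derive_eq (is_derive_comp h (is_deriveNid _ _)) _.
    rewrite /spow ltr0_norm // mulrN1 -mulrN; congr (_ * _).
    by rewrite -(@powR_predM (s - 1) (- x)) ?oppr_gt0 // mulrN opprK.
- apply: (@near_eq_is_derive _ _ _ (fun y => y `^ s)).
  + by near=> y; rewrite gtr0_norm //; near: y; exact: lt_nbhsr.
  + apply: is_derive_eq (is_derive1_powR s x0) _.
    by rewrite /spow gtr0_norm // powR_predM.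
Unshelve. all: by end_near. Qed.

Lemma norm_powR_continuous : continuous (fun x => `|x| `^ p).
Proof.
move=> x; have [->|x0] := eqVneq x 0; last first.
  have [d _] := is_derive_powR_norm p x0.
  exact/differentiable_continuous/derivable1_diffP.
rewrite /continuous_at normr0 powR0 ?gt_eqF //; apply/cvgrPdist_lt => e e0.
have e1 : 0 < e `^ p^-1 by exact: powR_gt0.
have := @nbhs0_lt _ R _ e1; apply: filterS => y ye.
rewrite sub0r normrN ger0_norm ?powR_ge0 //.
have -> : e = (e `^ p^-1) `^ p.
  by rewrite -powRrM mulVf ?gt_eqF // powRr1 // ltW.
by rewrite gt0_ltr_powR ?nnegrE ?powR_ge0.
Qed.

(** At 0 the difference quotient is [spow p], which is continuous there because [p > 0]. Energies
    built on these powers can thus be differentiated through zeros without sign cases. *)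
Lemma is_derive_norm_powR x :
  is_derive x 1 (fun y => `|y| `^ (p + 1)) ((p + 1) * spow p x).
Proof.
have [->|x0] := eqVneq x 0; last first.
  by apply: is_derive_eq (is_derive_powR_norm (p + 1) x0) _; rewrite addrK.
apply/is_derive1_caratheodory; exists (spow p); split.
- by move=> z; rewrite subr0 normr0 powR0 ?gt_eqF ?addr_gt0 // subr0 spow_mul.
- apply/cvgrPdist_lt => e e0.
  have /cvgrPdist_lt /(_ e e0) := @norm_powR_continuous 0.
  apply: filterS => y; rewrite /spow mulr0 normr0 powR0 ?gt_eqF // !sub0r.
  by rewrite !normrN -/(spow p y) normr_spow (ger0_norm (powR_ge0 _ _)).
- by rewrite /spow !mulr0.
Qed.

End SignedPower.

(** * The radial system *)

(* m stands for N - 1.  Df is a continuous extension to both endpoints of the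
   derivative of f, which the differential equation controls only inside. *)
Definition radial_ode (R : realType) (m : nat) (rho b q : R)
    (f Df g : R -> R) : Prop :=
  [/\ {within `[0, rho], continuous f}, {within `[0, rho], continuous Df},
      forall r, r \in `]0, rho[ -> is_derive r 1 f (Df r),
      forall r, r \in `]0, rho[ ->
        is_derive r 1 Df (- (m%:R / r * Df r) - r `^ b * spow q (g r)) &
      f rho = 0].

Section RadialSystem.
Variables (R : realType) (rho : R).
Hypothesis rho0 : 0 < rho.
Implicit Types (f g Df Dg h : R -> R) (a b p q s : R) (m : nat).

(** The nonlinearity is odd. This symmetry gives each boundary slope implication its mirror
    image. *)
Lemma radial_odeN m b q f Df g : radial_ode m rho b q f Df g ->
  radial_ode m rho b q (fun r => - f r) (fun r => - Df r) (fun r => - g r).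
Proof.
move=> [cf cDf df dDf fr]; split.
- by move=> x; apply: cvgN; exact: cf.
- by move=> x; apply: cvgN; exact: cDf.
- by move=> r rI; apply: is_derive_opp; exact: df.
- move=> r rI; apply: is_derive_eq (is_derive_opp (dDf _ rI)) _.
  by rewrite spowN; ring.
- by rewrite fr oppr0.
Qed.

(** The integrating factor [r ^+ m] absorbs the first-order term. *)
Lemma is_derive_flux m b q Df g (r : R) : 0 < r ->
  is_derive r 1 Df (- (m%:R / r * Df r) - r `^ b * spow q (g r)) ->
  is_derive r 1 (fun s => s ^+ m * Df s) (- (r ^+ m * r `^ b * spow q (g r))).
Proof.
move=> /gt_eqF/negbT r0 dDf.
apply: is_derive_eq (is_derive_mul (is_derive_expn r m) dDf) _.
case: m {dDf} => [|m] /=; first by rewrite !expr0; field.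
by rewrite exprS; field.
Qed.

(** Matches the weight obtained by differentiating [|r|] to the power [m + b + 1] with the weight in
    the equation. *)
Lemma spow_expn m b r : (0 < m)%N -> 0 < r ->
  spow (m%:R + b) r = r ^+ m * r `^ b.
Proof.
move=> m0 r0; rewrite /spow gtr0_norm // powR_predM //.
by rewrite powRD ?(gt_eqF r0) ?implybT // powR_mulrn ?ltW.
Qed.

Lemma within_continuous_expn m (A : set R) :
  {within A, continuous (fun r : R => r ^+ m)}.
Proof. by apply: continuous_subspaceT; exact: exprn_continuous. Qed.

Lemma within_continuous_norm_powR s (A : set R) h : 0 < s ->
  {within A, continuous h} -> {within A, continuous (fun r => `|h r| `^ s)}.
Proof.
move=> s0 ch x.
have hc := @norm_powR_continuous R s s0 (h x).
exact: (@continuous_comp (subspace A) R R h _ x (ch x) hc).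
Qed.

(** A Pohozaev identity in differential form: comparing [E] at both ends replaces integration over
    the ball. *)
Lemma pohozaev_boundary_le0 m a b p q f Df g Dg : (1 < m)%N ->
  0 <= a -> 0 <= b -> 0 < p -> 0 < q ->
  (m.+1%:R + a) / (p + 1) + (m.+1%:R + b) / (q + 1) <= m.+1%:R - 2 ->
  radial_ode m rho b q f Df g -> radial_ode m rho a p g Dg f ->
  Df rho * Dg rho <= 0.
Proof.
move=> m1 a0 b0 p0 q0 hpq odef odeg.
have [cf cDf df dDf fr] := odef; have [cg cDg dg dDg gr] := odeg.
pose A := (m.+1%:R + b) / (q + 1); pose B := m.+1%:R - 2 - A.
(* The weights A and B sum to N - 2, which cancels the Df * Dg terms of the
   derivative of E; A also cancels the g terms. *)
pose E r := r ^+ m.+1 * (Df r * Dg r)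
  + (q + 1)^-1 * (`|r| `^ (m%:R + b + 1) * `|g r| `^ (q + 1))
  + (p + 1)^-1 * (`|r| `^ (m%:R + a + 1) * `|f r| `^ (p + 1))
  + r ^+ m * (A * (g r * Df r) + B * (f r * Dg r)).
have mR : 0 < m%:R :> R by rewrite ltr0n ltnW.
have mb : 0 < m%:R + b by rewrite ltr_wpDr.
have ma : 0 < m%:R + a by rewrite ltr_wpDr.
have : E rho <= E 0.
  (* Only the term in [|f|] to the power [p + 1] survives, and the hypothesis on the exponents says
     exactly that its coefficient is nonpositive. *)
  pose dE r := - (B - (m.+1%:R + a) / (p + 1)) *
    (r ^+ m * r `^ a * `|f r| `^ (p + 1)).
  apply: (@derive_le0_nincr _ E dE); first exact: ltW.
  - have cX k : {within `[0, rho], continuous (fun r : R => r ^+ k)}.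
      exact: within_continuous_expn.
    have cP s h : 0 < s -> {within `[0, rho], continuous h} ->
        {within `[0, rho], continuous (fun r => `|h r| `^ (s + 1))}.
      by move=> s0; apply: within_continuous_norm_powR; rewrite addr_gt0.
    have ci : {within `[0, rho], continuous (fun r : R => r)}.
      by apply: continuous_subspaceT => ?; exact: cvg_id.
    move=> x; apply: cvgD; first apply: cvgD; first apply: cvgD.
    + by apply: cvgM; [exact: cX|apply: cvgM; [exact: cDf|exact: cDg]].
    + by apply: cvgM; [exact: cvg_cst|apply: cvgM; exact: cP].
    + by apply: cvgM; [exact: cvg_cst|apply: cvgM; exact: cP].
    + apply: cvgM; [exact: cX|apply: cvgD]; apply: cvgM; try exact: cvg_cst;
        by apply: cvgM; [exact: cf||exact: cg|exact: cDf||exact: cDg].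
  - move=> r rI; have r0 : 0 < r by move: rI; rewrite in_itv => /andP[].
    have [df' dDf'] := (df _ rI, dDf _ rI); have [dg' dDg'] := (dg _ rI, dDg _ rI).
    have dcst c : is_derive r 1 (fun=> c : R) 0 by exact: is_derive_cst.
    have dw c s (s0 : 0 < s) t (t0 : 0 < t) h dh (dh' : is_derive r 1 h dh) :=
      is_derive_mul (dcst c) (is_derive_mul (is_derive_norm_powR s0 r)
        (is_derive_comp (is_derive_norm_powR t0 (h r)) dh')).
    have dE1 := is_derive_mul (is_derive_expn r m.+1) (is_derive_mul dDf' dDg').
    have dE2 := dw (q + 1)^-1 _ mb _ q0 _ _ dg'.
    have dE3 := dw (p + 1)^-1 _ ma _ p0 _ _ df'.
    have dE4 := is_derive_mul (is_derive_expn r m) (is_derive_add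
      (is_derive_mul (dcst A) (is_derive_mul dg' dDf'))
      (is_derive_mul (dcst B) (is_derive_mul df' dDg'))).
    apply: is_derive_eq
      (is_derive_add (is_derive_add (is_derive_add dE1 dE2) dE3) dE4) _.
    (* Writing powers of exponent [s + 1] as [spow s x * x] turns both sides into rational
       expressions in common atoms; splitting [m] removes [m.-1]. *)
    rewrite -!spow_mul // !spow_expn ?(ltnW m1) // /dE /B /A.
    case: (m) m1 => // k _ /=.
    rewrite -!spow_mul // !exprS -!natr1; field.
    by rewrite !gt_eqF // addr_gt0.
  - move=> r; rewrite in_itv => /andP[/ltW r0 _]; rewrite /dE mulNr oppr_le0.
    apply: mulr_ge0; first by rewrite subr_ge0 /B /A; lra.
    by rewrite !mulr_ge0 ?powR_ge0 ?exprn_ge0.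
(* At [rho] the boundary conditions leave only the product of the slopes; at 0 every term carries a
   positive power of [r]. *)
rewrite /E fr gr !normr0 !expr0n /= !powR0 ?gt_eqF ?(addr_gt0 _ ltr01) //;
  last exact: ltnW.
rewrite !(mulr0n, mulr0, mul0r, addr0).
by rewrite pmulr_rle0 // exprn_gt0.
Qed.

(** The witness is the supremum of the points where [h] is nonpositive. Were [h] positive there, it
    would be positive nearby, although such points accumulate at their supremum. *)
Lemma last_nonpos h a b : a <= b -> {within `[a, b], continuous h} ->
  h a <= 0 -> exists s, [/\ s \in `[a, b], h s <= 0 &
    forall r, r \in `]s, b] -> 0 < h r].
Proof.
move=> ab ch ha; pose S := [set s | s \in `[a, b] /\ h s <= 0].
have Sa : S a by split; rewrite // in_itv /= lexx.
have ubS : ubound S b by move=> s [+ _]; rewrite in_itv => /andP[].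
have supS : has_sup S by split; [exists a|exists b].
have sI : sup S \in `[a, b].
  rewrite in_itv /=; apply/andP; split; first exact: ub_le_sup (proj2 supS) _ Sa.
  by apply: ge_sup => //; exists a.
exists (sup S); split => //; last first.
  move=> r; rewrite in_itv /= => /andP[sr rb]; rewrite ltNge; apply/negP => hr.
  have : r <= sup S.
    apply: ub_le_sup; first exact: (proj2 supS).
    split => //; rewrite in_itv /= rb andbT.
    by move: sI; rewrite in_itv /= => /andP[/le_trans -> //]; exact: ltW.
  by rewrite leNgt sr.
rewrite leNgt; apply/negP => hs.
have /subspace_continuousP /(_ _ sI) hc := ch.
have /nbhs_ballP[d /= d0 hd] : \forall x \near sup S, x \in `[a, b] -> 0 < h x.
  exact: (cvgr_gt (h (sup S)) hc).
have [s [sI' hs'] sd] := sup_adherent d0 supS.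
suff : 0 < h s by rewrite ltNge hs'.
apply: hd => //=; rewrite /ball /= ger0_norm ?subr_ge0; last first.
  by apply: ub_le_sup; [exact: (proj2 supS)|split].
by rewrite ltrBlDr addrC -ltrBlDr.
Qed.

(* Backwards from the boundary, as long as the flux of f stays positive, f is
   negative, so the flux of g is negative, g is positive, and the flux of f
   increases further: it could not vanish at the origin. *)
Lemma boundary_slope_le0 m a b p q f Df g Dg : (0 < m)%N -> 0 < p -> 0 < q ->
  radial_ode m rho b q f Df g -> radial_ode m rho a p g Dg f ->
  Dg rho <= 0 -> Df rho <= 0.
Proof.
move=> m0 p0 q0 odef odeg Dg0; rewrite leNgt; apply/negP => Df0.
have [cf cDf df dDf fr] := odef; have [cg cDg dg dDg gr] := odeg.
pose F r := r ^+ m * Df r; pose G r := r ^+ m * Dg r.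
have cX : {within `[0, rho], continuous (fun r : R => r ^+ m)}.
  exact: within_continuous_expn.
have cF : {within `[0, rho], continuous F}.
  by move=> x; apply: cvgM; [exact: cX|exact: cDf].
have cG : {within `[0, rho], continuous G}.
  by move=> x; apply: cvgM; [exact: cX|exact: cDg].
have F0 : F 0 <= 0 by rewrite /F expr0n gtn_eqF // mul0r.
have Frho : 0 < F rho by rewrite mulr_gt0 ?exprn_gt0.
(* All sign information is propagated backwards on [[s, rho]] only, where [F] is positive except at
   [s]. *)
have [s [sI Fs Fpos]] := last_nonpos (ltW rho0) cF F0.
have /andP[s0 srho] : 0 <= s <= rho by move: sI; rewrite in_itv.
have sub r : r \in `[s, rho] -> {subset `[r, rho] <= `[0, rho]}.
  rewrite in_itv /= => /andP[sr _] x; rewrite !in_itv /= => /andP[rx ->].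
  by rewrite (le_trans s0) // (le_trans sr).
have within_sub r h : r \in `[s, rho] -> {within `[0, rho], continuous h} ->
    {within `[r, rho], continuous h}.
  by move=> rI; apply: continuous_subspaceW => x; exact: sub rI x.
have inner r x : r \in `[s, rho] -> x \in `]r, rho[ ->
    [/\ x \in `]0, rho[, x \in `[s, rho], x \in `]s, rho] & 0 < x].
  rewrite !in_itv /= => /andP[sr _] /andP[rx xr].
  have sx := le_lt_trans sr rx; have x0 := le_lt_trans s0 sx.
  by rewrite x0 xr sx !ltW.
have rr r : r \in `[s, rho] -> r <= rho by rewrite in_itv => /andP[].
have fle r : r \in `[s, rho] -> f r <= 0.
  move=> rI; rewrite -[leRHS]fr.
  have d x : x \in `]r, rho[ -> is_derive x 1 f (Df x).
    by move=> /(inner _ _ rI)[xI _ _ _]; exact: df.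
  have D0 x : x \in `]r, rho[ -> 0 <= Df x.
    move=> /(inner _ _ rI)[_ _ /Fpos + x0].
    by rewrite /F pmulr_rgt0 ?exprn_gt0 // => /ltW.
  exact (derive_ge0_ndecr (rr _ rI) (within_sub _ _ rI cf) d D0).
have Gle r : r \in `[s, rho] -> G r <= 0.
  move=> rI; apply: (@le_trans _ _ (G rho)); last first.
    by rewrite /G mulr_ge0_le0 // exprn_ge0 // ltW.
  have d x (xI : x \in `]r, rho[) :=
    let: And4 xI' _ _ x0 := inner _ _ rI xI in is_derive_flux x0 (dDg _ xI').
  have D0 x : x \in `]r, rho[ -> 0 <= - (x ^+ m * x `^ a * spow p (f x)).
    move=> /(inner _ _ rI)[_ xI _ x0].
    rewrite oppr_ge0 mulr_ge0_le0 ?spow_le0 ?fle //.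
    by rewrite mulr_ge0 ?powR_ge0 ?exprn_ge0 ?ltW.
  exact (derive_ge0_ndecr (rr _ rI) (within_sub _ _ rI cG) d D0).
have gge r : r \in `[s, rho] -> 0 <= g r.
  move=> rI; rewrite -[leLHS]gr.
  have d x : x \in `]r, rho[ -> is_derive x 1 g (Dg x).
    by move=> /(inner _ _ rI)[xI _ _ _]; exact: dg.
  have D0 x : x \in `]r, rho[ -> Dg x <= 0.
    move=> /(inner _ _ rI)[_ /Gle + _ x0].
    by rewrite /G pmulr_rle0 ?exprn_gt0.
  exact (derive_le0_nincr (rr _ rI) (within_sub _ _ rI cg) d D0).
have sI' : s \in `[s, rho] by rewrite in_itv /= lexx.
(* Since [g] is nonnegative on [[s, rho]], [F] is nonincreasing there, against
   [F s <= 0 < F rho]. *)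
suff : F rho <= F s by move=> /le_trans /(_ Fs); rewrite leNgt Frho.
have d x (xI : x \in `]s, rho[) :=
  let: And4 xI' _ _ x0 := inner _ _ sI' xI in is_derive_flux x0 (dDf _ xI').
have D0 x : x \in `]s, rho[ -> - (x ^+ m * x `^ b * spow q (g x)) <= 0.
  move=> /(inner _ _ sI')[_ xI _ x0].
  rewrite oppr_le0 mulr_ge0 ?spow_ge0 ?gge //.
  by rewrite mulr_ge0 ?powR_ge0 ?exprn_ge0 ?ltW.
exact (derive_le0_nincr (rr _ sI') (within_sub _ _ sI' cF) d D0).
Qed.

End RadialSystem.

(** * Backward uniqueness from zero Cauchy data, and triviality of radial solutions *)

Section Uniqueness.
Variables (R : realType) (rho : R).
Hypothesis rho0 : 0 < rho.
Implicit Types (f g Df Dg h : R -> R) (a b p q s t : R) (m : nat).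

(** A Young inequality without sharp constants: bound the smaller factor by the larger one. *)
Lemma powR_mul_le s (x y : R) : 0 < s -> 0 <= x -> 0 <= y ->
  x `^ s * y <= x `^ (s + 1) + y `^ (s + 1).
Proof.
move=> s0 x0 y0; have s10 := addr_gt0 s0 (ltr01 : 0 < 1 :> R).
have E z : 0 <= z -> z `^ (s + 1) = z `^ s * z.
  by move=> z0; rewrite -[LHS]mulr_powRB1 // addrK mulrC.
have [xy|yx] := leP x y.
  rewrite (E y) // -[leLHS]add0r lerD ?powR_ge0 // ler_wpM2r //.
  by rewrite ge0_ler_powR ?nnegrE ?(ltW s0).
rewrite (E x) // -[leLHS]addr0 lerD ?powR_ge0 // ler_wpM2l ?powR_ge0 //.
exact: ltW.
Qed.

Lemma within_itv_bounded h : {within `[0, rho], continuous h} ->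
  exists2 M, 0 <= M & forall r, r \in `[0, rho] -> `|h r| <= M.
Proof.
move=> ch; have cn : {within `[0, rho], continuous (fun r => `|h r|)}.
  by move=> x; apply: cvg_norm; exact: ch.
by have [c _ hc] := EVT_max (ltW rho0) cn; exists `|h c|.
Qed.

(** The right side is the derivative of the part of the energy in [f] and [Df]; the bound is half of
    the inequality fed to [gronwall_backward]. Staying above [e > 0] keeps [m / r] bounded. *)
Lemma energy_derive_bound m b q s t e f Df g : 0 <= b -> 0 < q -> 0 < s ->
  0 < t -> t / (s + 1) <= q -> 0 < e ->
  {within `[0, rho], continuous g} ->
  exists2 C, 0 <= C & forall r, r \in `[e, rho] ->
    - (C * (`|f r| `^ (s + 1) + `|Df r| `^ (s + 1) + `|g r| `^ t)) <=
    (s + 1) * spow s (f r) * Df r +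
    (s + 1) * spow s (Df r) * (- (m%:R / r * Df r) - r `^ b * spow q (g r)).
Proof.
move=> b0 q0 s0 t0 tsq e0 cg.
have s1 : 0 < s + 1 by rewrite addr_gt0.
have [M M0 gM] := within_itv_bounded cg.
(* The power [q] of [|g|] is split in two: [K] bounds the part of nonnegative exponent
   [q - t / (s + 1)], and the part of exponent [t / (s + 1)] yields [Z] through [powR_mul_le]. *)
pose K := M `^ (q - t / (s + 1)).
have K0 : 0 <= K by exact: powR_ge0.
have rb0 : 0 <= rho `^ b by exact: powR_ge0.
have me0 : 0 <= m%:R / e by rewrite divr_ge0 // ltW.
exists ((s + 1) * (1 + m%:R / e + rho `^ b * K)).
  by rewrite mulr_ge0 ?(ltW s1) // !addr_ge0 // mulr_ge0.
move=> r; rewrite in_itv /= => /andP[er rrho].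
have r0 : 0 < r by exact: lt_le_trans er.
have /gM gr : r \in `[0, rho] by rewrite in_itv /= ltW.
set X := `|f r| `^ (s + 1); set Y := `|Df r| `^ (s + 1); set Z := `|g r| `^ t.
have [X0 Y0 Z0] : [/\ 0 <= X, 0 <= Y & 0 <= Z] by split; exact: powR_ge0.
have T1 : `|spow s (f r) * Df r| <= X + Y.
  by rewrite normrM normr_spow // powR_mul_le.
have T2 : `|spow s (Df r) * (m%:R / r * Df r)| <= m%:R / e * Y.
  rewrite mulrCA normrM ger0_norm ?divr_ge0 ?(ltW r0) // spow_mul //.
  by rewrite ger0_norm ?powR_ge0 // ler_wpM2r // ler_wpM2l // lef_pV2 ?posrE.
have T3 : `|spow s (Df r) * (r `^ b * spow q (g r))| <= rho `^ b * K * (Y + Z).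
  rewrite mulrCA normrM ger0_norm ?powR_ge0 // -mulrA.
  apply: ler_pM; rewrite ?powR_ge0 //.
    by rewrite ge0_ler_powR ?nnegrE ?(ltW r0) ?(ltW rho0).
  rewrite normrM !normr_spow //.
  have -> : `|g r| `^ q = `|g r| `^ (q - t / (s + 1)) * `|g r| `^ (t / (s + 1)).
    by rewrite -powRD subrK // gt_eqF.
  rewrite mulrCA ler_pM ?powR_ge0 ?mulr_ge0 ?powR_ge0 //.
    by rewrite ge0_ler_powR ?nnegrE ?subr_ge0.
  apply: le_trans (powR_mul_le s0 _ _) _; rewrite ?powR_ge0 //.
  by rewrite -powRrM divfK ?gt_eqF.
move: T1 T2 T3; rewrite !ler_norml => /andP[T1 _] /andP[_ T2] /andP[_ T3].
have YZ : 0 <= m%:R / e * (X + Z) by rewrite mulr_ge0 ?addr_ge0.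
have XK : 0 <= rho `^ b * K * X by rewrite !mulr_ge0.
move: T1 T2 T3 YZ XK.
have -> k1 k2 S T x y : - ((s + 1) * (1 + k1 + k2) * (X + Y + Z)) <=
    (s + 1) * S * Df r + (s + 1) * T * (- x - y) =
    (- ((1 + k1 + k2) * (X + Y + Z)) <= S * Df r - T * x - T * y).
  by rewrite -[RHS](ler_pM2l s1); congr (_ <= _); ring.
move: (m%:R / e) (rho `^ b * K) (spow s (f r) * _)
  (spow s (Df r) * (m%:R / r * _)) (spow s (Df r) * (r `^ b * _)) => k1 k2 U V U'.
by rewrite !mulrDr !mulrDl; lra.
Qed.

(** The differential inequality says that [h r * expR (C * r)] is nondecreasing. *)
Lemma gronwall_backward C h dh a b : a <= b ->
  {within `[a, b], continuous h} ->
  (forall r, r \in `]a, b[ -> is_derive r 1 h (dh r)) ->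
  (forall r, r \in `]a, b[ -> - (C * h r) <= dh r) ->
  h b = 0 -> h a <= 0.
Proof.
move=> ab ch hd hC hb.
have cexp : continuous (fun r : R => expR (C * r)).
  move=> x; apply: (@continuous_comp _ _ _ (fun r : R => C * r) expR).
    exact: mulrl_continuous.
  exact: continuous_expR.
suff : h a * expR (C * a) <= h b * expR (C * b).
  by rewrite hb mul0r pmulr_lle0 ?expR_gt0.
apply: (@derive_ge0_ndecr _ (fun r => h r * expR (C * r))
  (fun r => (dh r + C * h r) * expR (C * r)) _ _ ab).
- move=> x; apply: cvgM; first exact: ch.
  exact: (continuous_subspaceT cexp).
- move=> r rI.
  apply: is_derive_eq (is_derive_mul (hd _ rI)
    (is_derive_comp (is_derive_expR _) (is_derive_scale C r))) _.
  by ring.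
- by move=> r /hC hr; rewrite mulr_ge0 ?expR_ge0 // -lerBlDr sub0r.
Qed.

(** Stated for [f] alone; exchanging the two equations gives the same for [g]. *)
Lemma zero_cauchy_data m a b p q f Df g Dg :
  0 <= a -> 0 <= b -> 0 < p -> 0 < q -> 1 <= p * q ->
  radial_ode m rho b q f Df g -> radial_ode m rho a p g Dg f ->
  Df rho = 0 -> Dg rho = 0 ->
  forall r, r \in `[0, rho] -> f r = 0.
Proof.
move=> a0 b0 p0 q0 pq odef odeg Dfr Dgr.
have [cf cDf df dDf fr] := odef; have [cg cDg dg dDg gr] := odeg.
(* With these exponents |g|^q and |f|^p are bounded by multiples of
   |g|^((t+1)/(s+1)) and |f|^((s+1)/(t+1)), because p q >= 1; so W satisfies a
   linear differential inequality although p or q may be less than 1. *)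
pose s := 2 * p + 1; pose t := 2 / p + 1.
have s0 : 0 < s by rewrite /s; lra.
have t0 : 0 < t by rewrite addr_gt0 ?divr_gt0.
have st : (s + 1) / (t + 1) = p.
  by rewrite /s /t; field; rewrite !gt_eqF //=; lra.
have ts : (t + 1) / (s + 1) <= q.
  have -> : (t + 1) / (s + 1) = p^-1 by rewrite -st invf_div.
  by rewrite -[p^-1]mul1r ler_pdivrMr // mulrC.
have st' : (s + 1) / (t + 1) <= p by rewrite st.
have cP l h : 0 < l -> {within `[0, rho], continuous h} ->
    {within `[0, rho], continuous (fun r => `|h r| `^ (l + 1))}.
  by move=> l0; apply: within_continuous_norm_powR; rewrite addr_gt0.
pose W r := `|f r| `^ (s + 1) + `|Df r| `^ (s + 1) +
            (`|g r| `^ (t + 1) + `|Dg r| `^ (t + 1)).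
(* Gronwall runs on [[e, rho]] because its constant involves [m / e]. The origin is reached
   afterwards: [f] has zero derivative inside, so it is constant. *)
have fDf e : 0 < e <= rho -> f e = 0 /\ Df e = 0.
  move=> /andP[e0 erho].
  have s1 : 0 < s + 1 by rewrite addr_gt0.
  have t1 : 0 < t + 1 by rewrite addr_gt0.
  have [C1 C10 H1] := energy_derive_bound m f Df b0 q0 s0 t1 ts e0 cg.
  have [C2 C20 H2] := energy_derive_bound m g Dg a0 p0 t0 s1 st' e0 cf.
  have : W e <= 0.
    have cW : {within `[e, rho], continuous W}.
      have cW0 : {within `[0, rho], continuous W}.
        by move=> x; apply: cvgD; apply: cvgD; exact: cP.
      apply: continuous_subspaceW cW0 => x /=.
      by rewrite !in_itv /= => /andP[/(le_trans (ltW e0)) -> ->].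
    pose pw (l : R) (l0 : 0 < l) (r : R) h (dh : R) (hd : is_derive r 1 h dh) :=
      is_derive_comp (is_derive_norm_powR l0 (h r)) hd.
    have in0 r : r \in `]e, rho[ -> r \in `]0, rho[.
      by rewrite !in_itv /= => /andP[/(lt_trans e0) -> ->].
    have dW r (rI : r \in `]e, rho[) := let rI' := in0 r rI in
      is_derive_add
        (is_derive_add (pw _ s0 _ _ _ (df _ rI')) (pw _ s0 _ _ _ (dDf _ rI')))
        (is_derive_add (pw _ t0 _ _ _ (dg _ rI')) (pw _ t0 _ _ _ (dDg _ rI'))).
    have Wr : W rho = 0.
      by rewrite /W fr gr Dfr Dgr !normr0 !powR0 ?gt_eqF // !addr0.
    refine (@gronwall_backward (C1 + C2) W _ _ _ erho cW dW _ Wr) => r.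
    rewrite in_itv /= => /andP[/ltW er /ltW rr].
    have rI : r \in `[e, rho] by rewrite in_itv /= er.
    apply: le_trans (lerD (H1 _ rI) (H2 _ rI)); rewrite /W.
    move: (powR_ge0 `|f r| (s + 1)) (powR_ge0 `|Df r| (s + 1)).
    move: (powR_ge0 `|g r| (t + 1)) (powR_ge0 `|Dg r| (t + 1)).
    move: (`|f r| `^ _) (`|Df r| `^ _) (`|g r| `^ _) (`|Dg r| `^ _).
    move=> x1 x2 x3 x4 h3 h4 h1 h2.
    have := mulr_ge0 C10 h4; have := mulr_ge0 C20 h2.
    by rewrite !(mulrDl, mulrDr); lra.
  rewrite /W => We.
  have h (z : R) : `|z| `^ (s + 1) <= 0 -> z = 0.
    move=> z0; apply: normr0_eq0; apply: (@powR_eq0_eq0 _ _ (s + 1)); apply/eqP.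
    by rewrite eq_le z0 powR_ge0.
  have := powR_ge0 `|f e| (s + 1); have := powR_ge0 `|Df e| (s + 1).
  have := powR_ge0 `|g e| (t + 1); have := powR_ge0 `|Dg e| (t + 1).
  by move=> *; split; apply: h; lra.
move=> r; rewrite in_itv /= => /andP[]; rewrite le_eqVlt => /predU1P[<- _|r0 rr].
  have D0 x : x \in `]0, rho[ -> Df x = 0.
    by rewrite in_itv /= => /andP[x0 /ltW xr]; have [|_ ->] := fDf x; rewrite ?x0.
  apply/eqP; rewrite eq_le -[X in _ <= X]fr -[X in X <= f 0]fr; apply/andP; split.
    refine (derive_ge0_ndecr (ltW rho0) cf df _) => x xI.
    by rewrite D0.
  refine (derive_le0_nincr (ltW rho0) cf df _) => x xI.
  by rewrite D0.
by have [] := fDf r; rewrite ?r0.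
Qed.

(** Dropping [a] and [b] gives [1/(p+1) + 1/(q+1) < 1]; clearing denominators yields
    [p + q + 2 < (p+1)(q+1)]. *)
Lemma supercritical_prod_gt1 m a b p q :
  0 <= a -> 0 <= b -> 0 < p -> 0 < q ->
  (m.+1%:R + a) / (p + 1) + (m.+1%:R + b) / (q + 1) <= m.+1%:R - 2 ->
  1 < p * q.
Proof.
move=> a0 b0 p0 q0 hpq; have p1 : 0 < p + 1 by lra.
have q1 : 0 < q + 1 by lra.
have n0 : 0 < m.+1%:R :> R by [].
set n := m.+1%:R in hpq n0.
have : n * ((p + 1)^-1 + (q + 1)^-1) < n * 1.
  rewrite mulr1; apply: (@le_lt_trans _ _ (n - 2)); last by lra.
  apply: le_trans hpq; rewrite mulrDr.
  by rewrite lerD // ler_wpM2r ?invr_ge0 ?(ltW p1) ?(ltW q1) ?lerDl.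
rewrite ltr_pM2l // => h.
have : (p + 1) * (q + 1) * ((p + 1)^-1 + (q + 1)^-1) < (p + 1) * (q + 1) * 1.
  by rewrite ltr_pM2l // mulr_gt0.
have -> : (p + 1) * (q + 1) * ((p + 1)^-1 + (q + 1)^-1) = p + q + 2.
  by field; rewrite !gt_eqF.
by rewrite mulr1; nra.
Qed.

(** The slope lemma, applied also to the exchanged and negated systems, gives both boundary slopes
    the same weak sign, while their product is nonpositive; so both vanish. *)
Lemma radial_ode_trivial m a b p q f Df g Dg : (1 < m)%N ->
  0 <= a -> 0 <= b -> 0 < p -> 0 < q ->
  (m.+1%:R + a) / (p + 1) + (m.+1%:R + b) / (q + 1) <= m.+1%:R - 2 ->
  radial_ode m rho b q f Df g -> radial_ode m rho a p g Dg f ->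
  forall r, r \in `[0, rho] -> f r = 0 /\ g r = 0.
Proof.
move=> m1 a0 b0 p0 q0 hpq odef odeg.
have m0 := ltnW m1.
have pq := supercritical_prod_gt1 a0 b0 p0 q0 hpq.
have prod := pohozaev_boundary_le0 rho0 m1 a0 b0 p0 q0 hpq odef odeg.
have slope := boundary_slope_le0 rho0 m0.
have slopeN : 0 <= Dg rho -> 0 <= Df rho.
  have := slope _ _ _ _ _ _ _ _ p0 q0 (radial_odeN odef) (radial_odeN odeg).
  by rewrite /= !oppr_le0.
have slope1 : Dg rho <= 0 -> Df rho <= 0 by exact: slope p0 q0 odef odeg.
have slope2 : Df rho <= 0 -> Dg rho <= 0 by exact: slope q0 p0 odeg odef.
have slope2N : 0 <= Df rho -> 0 <= Dg rho.
  have := slope _ _ _ _ _ _ _ _ q0 p0 (radial_odeN odeg) (radial_odeN odef).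
  by rewrite /= !oppr_le0.
have Df0 : Df rho = 0.
  apply/eqP; rewrite eq_le; apply/andP; split; rewrite leNgt; apply/negP => D0.
    suff /slope1 : Dg rho <= 0 by rewrite leNgt D0.
    by rewrite -(pmulr_rle0 _ D0).
  suff /slopeN : 0 <= Dg rho by rewrite leNgt D0.
  by rewrite -(nmulr_rle0 _ D0).
have Dg0 : Dg rho = 0.
  by apply/eqP; rewrite eq_le slope2 ?slope2N // Df0.
move=> r rI; split.
  exact: zero_cauchy_data a0 b0 p0 q0 (ltW pq) odef odeg Df0 Dg0 _ rI.
by apply: zero_cauchy_data b0 a0 q0 p0 _ odeg odef Dg0 Df0 _ rI; rewrite mulrC ltW.
Qed.

End Uniqueness.

(** * Continuity of the radial derivative up to the boundary *)

Section BoundarySlope.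
Variables (R : realType) (rho : R).
Hypothesis rho0 : 0 < rho.
Implicit Types (f g D h dh : R -> R) (b q : R) (m : nat).

(** The function [h r + K * r] is nondecreasing and bounded above near [rho], so it converges; then
    [K * r] is subtracted. *)
Lemma bounded_derive_cvg_left h dh K :
  {in `]0, rho[, continuous h} ->
  (forall r, r \in `]0, rho[ -> is_derive r 1 h (dh r)) ->
  (forall r, r \in `]0, rho[ -> `|dh r| <= K) ->
  exists l : R, h r @[r --> rho^'-] --> l.
Proof.
move=> ch hd hK.
have half0 : 0 < rho / 2 by rewrite divr_gt0.
have half1 : rho / 2 < rho by rewrite ltr_pdivrMr // ltr_pMr // ltr1n.
have inc r s : r \in `]0, rho[ -> s \in `]0, rho[ -> r <= s ->
    h r + K * r <= h s + K * s /\ h s - K * s <= h r - K * r.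
  move=> rI sI rs.
  have sub x : x \in `[r, s] -> x \in `]0, rho[.
    move: rI sI; rewrite !in_itv /= => /andP[r0 _] /andP[_ srho] /andP[rx xs].
    by rewrite (lt_le_trans r0 rx) (le_lt_trans xs srho).
  have sub' x : x \in `]r, s[ -> x \in `]0, rho[.
    move=> xI; apply: sub; move: xI; rewrite !in_itv /= => /andP[rx xs].
    by rewrite !ltW.
  have cl (k : R) : {within `[r, s], continuous (fun x => h x + k * x)}.
    apply: continuous_in_subspaceT => x; rewrite inE => /sub xI.
    by apply: cvgD; [exact: ch|exact: mulrl_continuous].
  have dhl (k x : R) (xI : x \in `]r, s[) := 
    is_derive_add (hd x (sub' x xI)) (is_derive_scale k x).
  split.
    refine (derive_ge0_ndecr rs (cl K) (dhl K) _) => x /sub' /hK.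
    by rewrite ler_norml => /andP[? _]; rewrite -lerBlDr sub0r.
  rewrite -!mulNr.
  refine (derive_le0_nincr rs (cl (- K)) (dhl (- K)) _) => x /sub' /hK.
  by rewrite ler_norml subr_le0 => /andP[].
have cv : cvg (h r + K * r @[r --> rho^'-]).
  apply: nondecreasing_at_left_is_cvgr.
    near=> x => r s; rewrite !in_itv /= => /andP[xr rr] /andP[xs sr] rs.
    have x0 : 0 < x by near: x; exact: nbhs_left_gt.
    by have [] := inc r s; rewrite ?in_itv /= ?(lt_trans x0) // => /(_ isT isT rs).
  (* The bound adds twice [K * r] to the nonincreasing [h r - K * r]; absolute values avoid
     discussing the sign of [K]. *)
  near=> x; exists (h (rho / 2) - K * (rho / 2) + (`|K| + `|K|) * rho) => _ [r rI <-].
  move: rI; rewrite /= in_itv /= => /andP[xr rr].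
  have xh : rho / 2 < x by near: x; exact: nbhs_left_gt.
  have hr : rho / 2 < r by exact: lt_trans xr.
  have r0 : 0 < r by exact: lt_trans hr.
  have [_] : h (rho / 2) + K * (rho / 2) <= h r + K * r /\
      h r - K * r <= h (rho / 2) - K * (rho / 2).
    by apply: inc; rewrite ?in_itv /= ?half0 ?half1 ?r0 ?rr // ltW.
  have : K * r <= `|K| * rho.
    apply: le_trans (ler_norm _) _; rewrite normrM ler_wpM2l // ger0_norm ?ltW //.
  by rewrite mulrDl; lra.
exists (lim (h r + K * r @[r --> rho^'-]) - K * rho).
have : h r + K * r - K * r @[r --> rho^'-] -->
    lim (h r + K * r @[r --> rho^'-]) - K * rho.
  apply: cvgB; first exact: cv.
  apply: cvg_at_left_filter; exact: mulrl_continuous.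
by have -> : (fun r => h r + K * r - K * r) = h by apply/funext => r; rewrite addrK.
Unshelve. all: by end_near. Qed.

(** Differentiability at the boundary alone does not make the derivative continuous there. The
    equation does: the flux has a bounded derivative, hence a limit at [rho], and so has [D]. *)
Lemma radial_ode_extend m b q f D g : 0 <= b -> 0 < q ->
  {within `[0, rho], continuous f} -> {within `[0, rho], continuous g} ->
  (forall r, r \in `[0, rho[ -> {for r, continuous D}) ->
  (forall r, r \in `]0, rho[ -> is_derive r 1 f (D r)) ->
  (forall r, r \in `]0, rho[ ->
    is_derive r 1 D (- (m%:R / r * D r) - r `^ b * spow q (g r))) ->
  f rho = 0 -> exists Df, radial_ode m rho b q f Df g.
Proof.
move=> b0 q0 cf cg cD df dD fr.
have [M M0 gM] := within_itv_bounded rho0 cg.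
have in_co r : r \in `]0, rho[ -> r \in `[0, rho[.
  by rewrite !in_itv /= => /andP[/ltW -> ->].
have [l hl] : exists l : R, r ^+ m * D r @[r --> rho^'-] --> l.
  pose K := rho ^+ m * rho `^ b * M `^ q.
  have pos r : r \in `]0, rho[ -> 0 < r by rewrite in_itv => /andP[].
  have dF r (rI : r \in `]0, rho[) := is_derive_flux (pos r rI) (dD r rI).
  apply: (bounded_derive_cvg_left (K := K) _ dF).
    move=> r /in_co rI; apply: cvgM; [exact: exprn_continuous|exact: cD].
  move=> r; rewrite in_itv /= => /andP[r0 rr].
  rewrite normrN normrM normr_spow // normrM (ger0_norm (powR_ge0 _ _)).
  rewrite ger0_norm ?exprn_ge0 ?(ltW r0) //.
  have /gM gr : r \in `[0, rho] by rewrite in_itv /= !ltW.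
  rewrite ler_pM ?mulr_ge0 ?powR_ge0 ?exprn_ge0 ?(ltW r0) //.
    rewrite ler_pM ?powR_ge0 ?exprn_ge0 ?(ltW r0) //.
      by rewrite lerXn2r ?nnegrE ?(ltW r0) ?(ltW rr) ?(ltW rho0).
    by rewrite ge0_ler_powR ?nnegrE ?(ltW r0) ?(ltW rr) ?(ltW rho0).
  by rewrite ge0_ler_powR ?nnegrE ?(ltW q0).
pose Df r := if r < rho then D r else l / rho ^+ m.
have DfE r : r < rho -> \forall x \near r, D x = Df x.
  move=> rr; near=> x; rewrite /Df ifT //; near: x; exact: lt_nbhsl.
exists Df; split => //.
- apply/continuous_within_itvP => //; split.
  + move=> r rI; have rr : r < rho by move: rI; rewrite in_itv => /andP[].
    rewrite /continuous_at -(nbhs_singleton (DfE r rr)).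
    apply: cvg_trans (cD r (in_co r rI)); exact: near_eq_cvg (DfE r rr).
  + rewrite -(nbhs_singleton (DfE 0 rho0)).
    apply: cvg_at_right_filter.
    have c0 := cD 0 _; apply: cvg_trans (c0 _); first exact: near_eq_cvg (DfE 0 rho0).
    by rewrite in_itv /= lexx.
  + rewrite [X in _ --> X]/Df ltxx.
    apply: cvg_trans (_ : r ^+ m * D r / r ^+ m @[r --> rho^'-] --> _).
      apply: near_eq_cvg; near=> r.
      have r0 : 0 < r by near: r; exact: nbhs_left_gt.
      rewrite /Df ifT; first by rewrite mulrAC mulfV ?mul1r // expf_neq0 // gt_eqF.
      by near: r; exact: nbhs_left_lt.
    apply: cvgM => //; apply: cvgV; first by rewrite expf_neq0 // gt_eqF.
    apply: cvg_at_left_filter; exact: exprn_continuous.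
- move=> r rI; have rr : r < rho by move: rI; rewrite in_itv => /andP[].
  by rewrite -(nbhs_singleton (DfE r rr)); exact: df.
- move=> r rI; have rr : r < rho by move: rI; rewrite in_itv => /andP[].
  rewrite -(nbhs_singleton (DfE r rr)).
  exact: near_eq_is_derive (DfE r rr) (dD r rI).
Unshelve. all: by end_near. Qed.


End BoundarySlope.

(** * From the elliptic system to the radial one *)

Section RadialReduction.
Variables (R : realType) (m : nat).
Local Notation E := 'rV[R]_m.+1.
Implicit Types (u v w : E -> R) (x y : E) (r s t : R).

Local Notation e_ i := (delta_mx 0 i : E).

(** Both difference quotients are the same function of the increment. *)
Lemma is_derive_line w x y r : derivable w (x + r *: y) y ->
  is_derive r 1 (fun t => w (x + t *: y)) ('D_y w (x + r *: y)).
Proof.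
move=> d.
have H : (fun h : R => h^-1 *: (((fun t => w (x + t *: y)) \o shift r) (h *: 1) -
      w (x + r *: y))) =
    (fun h : R => h^-1 *: ((w \o shift (x + r *: y)) (h *: y) - w (x + r *: y))).
  apply/funext => h /=; congr (_ *: (w _ - _)).
  by rewrite [h *: 1]mulr1 scalerDl addrCA.
by split; rewrite /derivable /derive H.
Qed.

Lemma enorm_ge0 x : 0 <= enorm x.
Proof. exact: sqrtr_ge0. Qed.

Lemma enorm_axis r : enorm (r *: e_ ord0) = `|r|.
Proof.
rewrite /enorm (bigD1 ord0) //= big1 ?addr0.
  by rewrite !mxE !eqxx mulr1 sqrtr_sqr.
by move=> i i0; rewrite !mxE (negbTE i0) andbF mulr0 expr0n.
Qed.

Lemma enorm_axis_plane i r t : i != ord0 ->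
  enorm (r *: e_ ord0 + t *: e_ i) = Num.sqrt (r ^+ 2 + t ^+ 2).
Proof.
move=> i0; rewrite /enorm (bigD1 ord0) //= (bigD1 i) //= big1 ?addr0.
  by rewrite !mxE !eqxx (negbTE i0) eq_sym (negbTE i0) !(mulr1, mulr0) add0r addr0.
move=> j /andP[j0 ji].
by rewrite !mxE (negbTE j0) (negbTE ji) !andbF !mulr0 addr0 expr0n.
Qed.

Lemma enorm_continuous : continuous (@enorm R m.+1).
Proof.
move=> x; apply: (@continuous_comp _ _ _
  (fun y : E => \sum_(i < m.+1) y 0 i ^+ 2) Num.sqrt).
  apply: continuous_big => [|i _ y]; first exact: add_continuous.
  apply: (@continuous_comp _ _ _ (fun z : E => z 0 i) (fun s : R => s ^+ 2)).
    exact: coord_continuous.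
  exact: exprn_continuous.
exact: sqrt_continuous.
Qed.

Lemma closure_eball_le rho x : closure (eball rho) x -> enorm x <= rho.
Proof.
have cl : closed [set y : E | enorm y <= rho].
  apply: (@closed_comp _ _ (@enorm R m.+1) [set s | s <= rho]).
    by move=> y _; exact: enorm_continuous.
  exact: closed_le.
move=> cx; have : closure [set y : E | enorm y <= rho] x.
  by apply: closureS cx => y; exact: ltW.
by rewrite -((closure_id _).1 cl).
Qed.

Lemma closure_eball_axis rho r : 0 <= r <= rho -> 0 < rho ->
  closure (eball rho) (r *: e_ ord0).
Proof.
move=> /andP[r0]; rewrite le_eqVlt => /predU1P[-> {r r0}|rr] rho0; last first.
  by apply: subset_closure; rewrite /eball /= enorm_axis ger0_norm.
(* The endpoint is approached from inside along the axis. *)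
move=> B /(scalel_continuous (x := e_ ord0)) hB.
near rho^'- => t; exists (t *: e_ ord0); split.
  rewrite /eball /= enorm_axis ger0_norm; near: t; first exact: nbhs_left_lt.
  exact: nbhs_left_ge.
near: t; apply: cvg_within; exact: hB.
Unshelve. all: by end_near. Qed.

Lemma boundary_eball_axis rho : 0 < rho ->
  boundary (eball rho) (rho *: e_ ord0).
Proof.
move=> rho0; split; first by apply: closure_eball_axis; rewrite // lexx ltW.
move=> /interior_subset; rewrite /eball /= enorm_axis ger0_norm ?ltW //.
by rewrite ltxx.
Qed.

End RadialReduction.

(** * The Laplacian of a radial function on the first axis *)

Section RadialLaplacian.
Variables (R : realType) (m : nat) (rho : R).
Local Notation E := 'rV[R]_m.+1.
Local Notation e_ i := (delta_mx 0 i : E).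
Local Notation B := (@eball R m.+1 rho).
Implicit Types (u v : E -> R) (r s t : R).

Lemma is_derive_hypot r t : 0 < r ->
  is_derive t 1 (fun t => Num.sqrt (r ^+ 2 + t ^+ 2))
    (t / Num.sqrt (r ^+ 2 + t ^+ 2)).
Proof.
move=> r0; have p : 0 < r ^+ 2 + t ^+ 2 by rewrite ltr_pwDl ?exprn_gt0 ?sqr_ge0.
have dl : is_derive t 1 (fun t => r ^+ 2 + t ^+ 2) (0 + 2 * t ^+ 1).
  by apply: is_derive_add (is_derive_expn t 2); exact: is_derive_cst.
have ds := @is_derive_comp R Num.sqrt (fun t => r ^+ 2 + t ^+ 2) t _ _
  (is_derive1_sqrt p) dl.
apply: is_derive_eq ds _.
rewrite add0r expr1; field.
by rewrite gt_eqF // sqrtr_gt0.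
Qed.

Lemma derive_unique (f : R -> R) (x df df' : R) :
  is_derive x 1 f df -> is_derive x 1 f df' -> df = df'.
Proof. by move=> [_ <-] [_ <-]. Qed.

(* u (r e_0 + t e_i) = U (sqrt (r^2 + t^2)), differentiated twice at t = 0. *)
Lemma partial2_transverse u i r : i != ord0 -> 0 < r < rho -> C2_on B u ->
  radial_on (closure B) u ->
  partial i (partial i u) (r *: e_ ord0) = partial ord0 u (r *: e_ ord0) / r.
Proof.
move=> i0 /andP[r0 rr] C2 rad.
pose U s := u (s *: e_ ord0); pose D s := partial ord0 u (s *: e_ ord0).
pose h t := Num.sqrt (r ^+ 2 + t ^+ 2).
have dh t : is_derive t 1 h (t / h t) by exact: is_derive_hypot.
have ch : continuous h.
  by move=> t; have [d _] := dh t; exact/differentiable_continuous/derivable1_diffP.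
have h0 : h 0 = r by rewrite /h expr0n addr0 sqrtr_sqr gtr0_norm.
have hge0 t : 0 <= h t by exact: sqrtr_ge0.
have ballh t : h t < rho -> B (h t *: e_ ord0).
  by rewrite /eball /= enorm_axis ger0_norm.
have ballp t : h t < rho -> B (r *: e_ ord0 + t *: e_ i).
  by rewrite /eball /= enorm_axis_plane.
have near_h t : h t < rho -> \forall s \near t, h s < rho.
  move=> ht; have c : h s @[s --> t] --> h t by exact: ch.
  exact: (cvgr_lt (h t) c).
have uh t : h t < rho -> u (r *: e_ ord0 + t *: e_ i) = U (h t).
  move=> ht; apply: rad; [exact/subset_closure/ballp|exact/subset_closure/ballh|].
  by rewrite enorm_axis_plane // enorm_axis ger0_norm.
have dU s : `|s| < rho -> is_derive s 1 U (D s).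
  move=> sr; have /C2[_ /(_ ord0)[d _]] : B (s *: e_ ord0).
    by rewrite /eball /= enorm_axis.
  have := @is_derive_line R m u 0 (e_ ord0) s.
  rewrite add0r => /(_ d).
  by have -> : (fun t => u (0 + t *: e_ ord0)) = U by apply/funext => t; rewrite add0r.
(* Needed for all [t] near 0 and not only at 0, because it is differentiated once more. *)
have first t : h t < rho ->
    partial i u (r *: e_ ord0 + t *: e_ i) = D (h t) * (t * (h t)^-1).
  move=> ht; have [_ /(_ i)[d _]] := C2 _ (ballp t ht).
  have dl := is_derive_line d.
  apply: derive_unique dl _.
  have dUh : is_derive t 1 (fun t => U (h t)) (D (h t) * (t / h t)).
    by apply: is_derive_comp (dh t); apply: dU; rewrite ger0_norm.
  apply: near_eq_is_derive dUh.
  by apply: filterS (near_h t ht) => s hs; rewrite uh.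
have hr : h 0 < rho by rewrite h0.
have [_ /(_ i)[_ [_ /(_ i)[d2 _]]]] := C2 _ (ballp 0 hr).
have dl := is_derive_line d2.
rewrite -[RHS]/(D r / r).
transitivity (partial i (partial i u) (r *: e_ ord0 + 0 *: e_ i)).
  by rewrite scale0r addr0.
apply: derive_unique dl _.
have Brr : B (r *: e_ ord0) by rewrite -h0; exact: ballh.
have dD : is_derive (h 0) 1 D (partial ord0 (partial ord0 u) (r *: e_ ord0)).
  rewrite h0; have [_ /(_ ord0)[_ [_ /(_ ord0)[d _]]]] := C2 _ Brr.
  have := @is_derive_line R m (partial ord0 u) 0 (e_ ord0) r.
  rewrite add0r => /(_ d).
  by have -> : (fun t => partial ord0 u (0 + t *: e_ ord0)) = D
    by apply/funext => t; rewrite add0r.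
have hn0 : h 0 != 0 by rewrite h0 gt_eqF.
have dV := is_deriveV hn0 (dh 0).
have did : is_derive (0 : R) 1 (fun t : R => t) 1 by exact: is_derive_id.
(* At [t = 0] both [t] and the derivative of [h] vanish, so only [D r / r] is left. *)
have dG := is_derive_mul (is_derive_comp dD (dh 0)) (is_derive_mul did dV).
have : is_derive (0 : R) 1 (fun t => D (h t) * (t * (h t)^-1)) (D r / r).
  by apply: is_derive_eq dG _; rewrite h0 !(mul0r, mulr0, add0r, addr0, mul1r).
apply: near_eq_is_derive; apply: filterS (near_h 0 hr) => s hs.
by rewrite first.
Qed.

(** Handles one equation, with [v] as given data, so that it can be applied twice with [u] and [v]
    exchanged. *)
Lemma radial_reduction u v b q : 0 < rho -> 0 <= b -> 0 < q ->
  C2_on B u -> differentiable_within (closure B) u ->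
  differentiable_within (closure B) v -> radial_on (closure B) u ->
  (forall x, B x -> laplacian u x + enorm x `^ b * spow q (v x) = 0) ->
  (forall x, boundary B x -> u x = 0) ->
  exists Df, radial_ode m rho b q (fun r => u (r *: e_ ord0)) Df
    (fun r => v (r *: e_ ord0)).
Proof.
move=> rho0 b0 q0 C2 du dv rad pde bd.
have cont w : differentiable_within (closure B) w ->
    {within `[0, rho], continuous (fun r => w (r *: e_ ord0))}.
  move=> dw; apply/subspace_continuousP => r /=; rewrite in_itv /= => rI.
  have cl s : s \in `[0, rho] -> closure B (s *: e_ ord0).
    by rewrite in_itv /= => sI; exact: closure_eball_axis.
  have [L HL] := dw _ (cl r rI).
  (* The error constant 1 suffices for continuity: near [r], [w] varies along the axis by at most
     [K] times the distance to [r]. *)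
  have HL1 := HL 1 ltr01.
  pose K := 1 + `|L (e_ ord0)|.
  have K0 : 0 < K by rewrite ltr_pwDl.
  apply/cvgrPdist_lt => e e0.
  have S1 : \forall s \near r, `|s - r| < e / K.
    have /cvgrPdist_lt /(_ _ (divr_gt0 e0 K0)) : s @[s --> r] --> r by exact: cvg_id.
    by apply: filterS => s; rewrite distrC.
  have S2 : \forall s \near r, closure B (s *: e_ ord0) ->
      `|w (s *: e_ ord0) - w (r *: e_ ord0) - L (s *: e_ ord0 - r *: e_ ord0)| <=
      1 * enorm (s *: e_ ord0 - r *: e_ ord0).
    exact: scalel_continuous HL1.
  suff : \forall s \near r, s \in `[0, rho] ->
    `|w (r *: e_ ord0) - w (s *: e_ ord0)| < e by [].
  apply: filterS2 S1 S2 => s sr Hs sI.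
  have := Hs (cl s sI); rewrite -scalerBl enorm_axis mul1r linearZ /= => H.
  rewrite distrC -[X in `|X|](subrK ((s - r) * L (e_ ord0))).
  apply: le_lt_trans (ler_normD _ _) _.
  apply: (@le_lt_trans _ _ (`|s - r| * K)).
    by rewrite normrM /K mulrDr mulr1 lerD2r.
  by rewrite -ltr_pdivlMr.
have inB r : r \in `[0, rho[ -> B (r *: e_ ord0).
  by rewrite in_itv /= => /andP[r0 rr]; rewrite /eball /= enorm_axis ger0_norm.
have in_co r : r \in `]0, rho[ -> r \in `[0, rho[.
  by rewrite !in_itv /= => /andP[/ltW -> ->].
have line w r : derivable w (r *: e_ ord0) (e_ ord0) ->
    is_derive r 1 (fun s => w (s *: e_ ord0)) (partial ord0 w (r *: e_ ord0)).
  have := @is_derive_line R m w 0 (e_ ord0) r; rewrite add0r.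
  by have -> : (fun t => w (0 + t *: e_ ord0)) = (fun t => w (t *: e_ ord0))
    by apply/funext => t; rewrite add0r.
apply: (@radial_ode_extend R rho rho0 m b q _
  (fun r => partial ord0 u (r *: e_ ord0))) => //.
- exact: cont.
- exact: cont.
(* This includes [r = 0], since the origin is an interior point of the ball. *)
- move=> r /inB /C2[_ /(_ ord0)[_ [_ /(_ ord0)[d _]]]].
  by have [d' _] := line _ _ d; exact/differentiable_continuous/derivable1_diffP.
- by move=> r /in_co /inB /C2[_ /(_ ord0)[d _]]; exact: line.
- move=> r rI; have [_ /(_ ord0)[_ [_ /(_ ord0)[d _]]]] := C2 _ (inB r (in_co r rI)).
  apply: is_derive_eq (line _ _ d) _.
  have rI' : 0 < r < rho by move: rI; rewrite in_itv.
  have /andP[r0 _] := rI'.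
  have := pde _ (inB r (in_co r rI)).
  rewrite enorm_axis gtr0_norm // /laplacian (bigD1 ord0) //=.
  (* The [m] transverse second derivatives coincide, which produces the coefficient [m / r]. *)
  rewrite (eq_bigr (fun=> partial ord0 u (r *: e_ ord0) / r)); last first.
    by move=> i i0; exact: partial2_transverse.
  rewrite sumr_const cardC1 card_ord /= -mulr_natl => H.
  by apply/eqP; rewrite -subr_eq0 -[X in _ == X]H; apply/eqP; field; rewrite gt_eqF.
- exact: bd (boundary_eball_axis m rho0).
Qed.

End RadialLaplacian.

Theorem theorem1p8 (R : realType) (N : nat) (alpha beta p q : R)
  (hN : (3 <= N)%N) (halpha : 0 <= alpha) (hbeta : 0 <= beta)
  (hp : 0 < p) (hq : 0 < q)
  (hpq : (N%:R + alpha) / (p + 1) + (N%:R + beta) / (q + 1) <= N%:R - 2)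
  (rho : R) (hrho : 0 < rho) :
  ~ exists u v : 'rV[R]_N -> R,
      [/\ classical_solution alpha beta p q (eball rho) u v,
          radial_on (closure (eball rho)) u,
          radial_on (closure (eball rho)) v &
          nontrivial_on (closure (eball rho)) u v].
Proof.
(* Here [m] is [N - 1], and [3 <= N] computes to [1 < m]. *)
case: N hN hpq => // m m1 hpq [u [v [[[C2u C2v] [du dv] pu pv bd] ru rv]]].
have [Df odeu] := radial_reduction hrho hbeta hq C2u du dv ru pu
  (fun x hx => proj1 (bd x hx)).
have [Dg odev] := radial_reduction hrho halpha hp C2v dv du rv pv
  (fun x hx => proj2 (bd x hx)).
have zero := radial_ode_trivial hrho m1 halpha hbeta hp hq hpq odeu odev.
move=> [x cx]; apply.
(* Radiality moves [x] to the point of the first axis with the same norm, where the one-variable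
   result applies. *)
have xI : 0 <= enorm x <= rho by rewrite enorm_ge0 closure_eball_le.
have cl := @closure_eball_axis R m rho _ xI hrho.
have ex : enorm x = enorm (enorm x *: (delta_mx 0 ord0 : 'rV[R]_m.+1)).
  by rewrite enorm_axis ger0_norm // enorm_ge0.
rewrite (ru _ _ cx cl ex) (rv _ _ cx cl ex).
by have [-> ->] := zero _ xI.
Qed.
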